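(* Let $k\geq 1$ be an integer. For every irreducible polynomial $P\in\mathcal{R}$ and for almost every $\alpha\in\mathfrak{m}$ (with respect to Haar measure), we have $\deg_{\min,P}(\alpha,q^{-k})=0$.
   Context: Let $q$ be a prime power, $\mathcal{R}=\mathbb{F}_q[x]$, $\mathcal{K}=\mathbb{F}_q(x)$ with absolute value $|f/g|=q^{\deg f-\deg g}$ (and $|0|=0$), and let $\mathcal{K}_\infty=\mathbb{F}_q((x^{-1}))$ be its completion. Let $\mathfrak{m}=\{\alpha\in\mathcal{K}_\infty:|\alpha|\leq q^{-1}\}$, with Haar measure normalized by giving $\mathfrak{m}$ measure $1$. For $\alpha\in\mathcal{K}_\infty$ and $\delta>0$, $$\deg_{\min}(\alpha,\delta)=\min\left\{d:\exists a\in\mathcal{R},\ b\in\mathcal{R}\setminus\{0\},\ \deg(b)=d,\ \left|\alpha-\frac{a}{b}\right|<\delta\right\}.$$ For an irreducible $P\in\mathcal{R}$, $\alpha\in\mathfrak{m}$ and $k\geq 1$, $$\deg_{\min,P}(\alpha,q^{-k})=\inf_{m\geq 0}\deg_{\min}(P^m\alpha,q^{-k}).$$ *)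

(* Defs.v *)
From HB Require Import structures.
From mathcomp Require Import all_boot all_order all_algebra.
From mathcomp Require Import all_classical all_reals all_analysis.
From mathcomp Require Import zify ring lra.

Set Implicit Arguments.
Unset Strict Implicit.
Unset Printing Implicit Defensive.

Import Order.TTheory GRing.Theory Num.Theory.

Local Open Scope classical_set_scope.
Local Open Scope ring_scope.

(* F((x^-1)): [f n] is the coefficient of x^n, so only finitely many positive
   exponents may occur. *)
Section Laurent.
Variable F : fieldType.

Definition bounded_by (f : int -> F) (N : int) := forall n, N < n -> f n = 0.

Definition is_laurent : pred (int -> F) :=
  fun f => `[< exists N, bounded_by f N >].

Record laurent := Laurent { lcoef :> int -> F; _ : lcoef \in is_laurent }.

HB.instance Definition _ := [isSub for lcoef].
HB.instance Definition _ := [Choice of laurent by <:].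

Lemma laurent_zmod_closed : zmod_closed is_laurent.
Proof.
split; first by apply/asboolP; exists 0.
move=> f g /asboolP[N fN] /asboolP[M gM]; apply/asboolP; exists (Num.max N M).
move=> n; rewrite gt_max => /andP[Nn Mn].
by rewrite -[LHS]/(f n - g n) fN// gM// subr0.
Qed.

HB.instance Definition _ :=
  GRing.isZmodClosed.Build (int -> F) is_laurent laurent_zmod_closed.
HB.instance Definition _ := [SubChoice_isSubZmodule of laurent by <:].

Implicit Types f g h : laurent.

Lemma lcoefP f g : (forall n, f n = g n) -> f = g.
Proof. by move=> fg; apply/val_inj/funext. Qed.

Lemma lcoef0 n : (0 : laurent) n = 0. Proof. by []. Qed.
Lemma lcoefD f g n : (f + g) n = f n + g n. Proof. by []. Qed.
Lemma lcoefN f n : (- f) n = - f n. Proof. by []. Qed.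
Lemma lcoefB f g n : (f - g) n = f n - g n. Proof. by []. Qed.

Lemma laurent_bound f : exists N, bounded_by f N.
Proof. by case: f => f /= /asboolP. Qed.

Lemma is_laurentP (f : int -> F) N : bounded_by f N -> f \in is_laurent.
Proof. by move=> fN; apply/asboolP; exists N. Qed.

Definition conv (f g : int -> F) (n : int) : F :=
  \sum_(i \in [set: int]) f i * g (n - i).

Lemma convE (f g : int -> F) (N M : int) (k : nat) :
  bounded_by f N -> bounded_by g M ->
  conv f g (N + M - k%:Z) =
  \sum_(i < k.+1) f (N - i%:Z) * g (M - (k - i)%N%:Z).
Proof.
move=> fN gM; rewrite /conv.
pose r := [seq N - i%:Z | i <- iota 0 k.+1].
rewrite -(fsbig_widen [set` r])//; last first.
  move=> i [_] /= ir; case: (ltP N i) => [/fN->|iN]; first by rewrite mul0r.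
  rewrite gM ?mulr0//; rewrite ltNge; apply/negP => iM; apply: ir.
  apply/mapP; exists (`|N - i|)%N; last by lia.
  by rewrite mem_iota; lia.
rewrite -fsbig_seq; last first.
  by rewrite map_inj_uniq ?iota_uniq// => i j; lia.
rewrite big_map -[iota 0 k.+1]/(index_iota 0 k.+1) big_mkord.
apply: eq_bigr => i _; congr (_ * g _).
have := ltn_ord i; lia.
Qed.

Lemma conv_bound (f g : int -> F) (N M : int) :
  bounded_by f N -> bounded_by g M -> bounded_by (conv f g) (N + M).
Proof.
move=> fN gM n Nn; apply: fsbig1 => i _.
case: (ltP N i) => [/fN->|iN]; first by rewrite mul0r.
by rewrite gM ?mulr0//; lia.
Qed.

Lemma conv_laurent f g : conv f g \in is_laurent.
Proof.
have [[N fN] [M gM]] := (laurent_bound f, laurent_bound g).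
exact: is_laurentP (conv_bound fN gM).
Qed.

Definition lmul f g : laurent := Laurent (conv_laurent f g).

(* The part x^N, ..., x^(N-k) of [f], read as a polynomial in x^-1. *)
Definition tpoly k (f : int -> F) (N : int) : {poly F} :=
  \poly_(i < k.+1) f (N - i%:Z).

Lemma coef_tpoly k (f : int -> F) N i :
  (i <= k)%N -> (tpoly k f N)`_i = f (N - i%:Z).
Proof. by move=> ik; rewrite coef_poly ltnS ik. Qed.

Lemma conv_coef k (f g : int -> F) N M i : bounded_by f N -> bounded_by g M ->
  (i <= k)%N -> conv f g (N + M - i%:Z) = (tpoly k f N * tpoly k g M)`_i.
Proof.
move=> fN gM ik; rewrite convE// coefM; apply: eq_bigr => j _.
by have := ltn_ord j => ji; rewrite !coef_tpoly//; lia.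
Qed.

Lemma tpolyM k (f g h : int -> F) N M L : bounded_by f N -> bounded_by g M ->
  (tpoly k (conv f g) (N + M) * tpoly k h L)`_k =
  (tpoly k f N * tpoly k g M * tpoly k h L)`_k.
Proof.
move=> fN gM; rewrite !coefM; apply: eq_bigr => j _.
have jk : (j <= k)%N by have := ltn_ord j; lia.
by rewrite coef_tpoly// (conv_coef (k := k)).
Qed.

Lemma lmulC : commutative lmul.
Proof.
move=> f g; apply: lcoefP => n /=.
have [[N fN] [M gM]] := (laurent_bound f, laurent_bound g).
have [Nn|nN] := ltP (N + M) n.
  by rewrite (conv_bound fN gM)// (conv_bound gM fN)//; lia.
have [k ->] : exists k : nat, n = N + M - k%:Z by exists `|(N + M - n)%R|%N; lia.
rewrite (conv_coef (k := k) fN gM)//.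
by rewrite [N + M]addrC (conv_coef (k := k) gM fN)// mulrC.
Qed.

Lemma lmulA : associative lmul.
Proof.
move=> f g h; apply: lcoefP => n /=.
have [[[N fN] [M gM]] [L hL]] :=
  (laurent_bound f, laurent_bound g, laurent_bound h).
have fgB := conv_bound fN gM; have ghB := conv_bound gM hL.
have [Nn|nN] := ltP (N + M + L) n.
  rewrite (_ : conv f _ n = 0); first by rewrite (conv_bound fgB hL).
  by rewrite (conv_bound fN ghB)//; lia.
have [k ->] : exists k : nat, n = N + M + L - k%:Z.
  by exists `|(N + M + L - n)%R|%N; lia.
rewrite (conv_coef (k := k) fgB hL)// tpolyM//.
rewrite -(addrA N M L) (conv_coef (k := k) fN ghB)//.
by rewrite [tpoly k f N * _]mulrC tpolyM// mulrC mulrA.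
Qed.

Definition lone_fun (n : int) : F := (n == 0)%:R.

Lemma lone_bound : bounded_by lone_fun 0.
Proof. by move=> n n0; rewrite /lone_fun gt_eqF. Qed.

Definition lone : laurent := Laurent (is_laurentP lone_bound).

Lemma lmul1 : left_id lone lmul.
Proof.
move=> f; apply: lcoefP => n /=.
rewrite /conv -(fsbig_widen [set 0%R])//; last first.
  by move=> i [_ /eqP i0] /=; rewrite /lone_fun (negbTE i0) mul0r.
by rewrite fsbig_set1 /lone_fun eqxx mul1r subr0.
Qed.

Lemma lmulDl : left_distributive lmul +%R.
Proof.
move=> f g h; apply: lcoefP => n /=.
have [[[N fN] [M gM]] [L hL]] :=
  (laurent_bound f, laurent_bound g, laurent_bound h).
pose K := Num.max N M.
have fK : bounded_by f K by move=> i iK; apply: fN; move: iK; rewrite gt_max => /andP[].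
have gK : bounded_by g K by move=> i iK; apply: gM; move: iK; rewrite gt_max => /andP[].
have fgK : bounded_by (f + g) K by move=> i iK; rewrite -[LHS]/(f i + g i) fK// gK// addr0.
rewrite -[RHS]/(conv f h n + conv g h n) -[LHS]/(conv (f + g) h n).
have [Nn|nN] := ltP (K + L) n.
  by rewrite (conv_bound fK hL)// (conv_bound gK hL)// (conv_bound fgK hL)// addr0.
have [k ->] : exists k : nat, n = K + L - k%:Z by exists `|(K + L - n)%R|%N; lia.
rewrite !convE// -big_split/=; apply: eq_bigr => i _.
by rewrite -mulrDl.
Qed.

Lemma lone_neq0 : lone != 0.
Proof.
apply/eqP => /(congr1 (fun f : laurent => f 0)); rewrite /= /lone_fun eqxx.
by move/eqP; rewrite oner_eq0.
Qed.

HB.instance Definition _ := GRing.Zmodule_isComNzRing.Build laurent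
  lmulA lmulC lmul1 lmulDl lone_neq0.

Lemma lcoefM f g n : (f * g) n = \sum_(i \in [set: int]) f i * g (n - i).
Proof. by []. Qed.

Lemma lcoef1 n : (1 : laurent) n = (n == 0)%:R. Proof. by []. Qed.

Definition has_ldeg f (N : int) := bounded_by f N /\ f N != 0.

Lemma ldeg_exists f : f != 0 -> exists N, has_ldeg f N.
Proof.
move=> f0; have [N fN] := laurent_bound f.
have /existsNP[n /eqP fn] : ~ forall n, f n = 0.
  by move=> fn; move/eqP: f0; apply; apply: lcoefP.
have nN : n <= N by rewrite leNgt; apply: contra fn => /fN ->.
have exk : exists k : nat, f (N - k%:Z) != 0.
  by exists `|N - n|%N; rewrite (_ : N - _ = n)//; lia.
case: (ex_minnP exk) => k fk kmin; exists (N - k%:Z); split=> // i iN.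
have [/fN//|{}iN'] := ltP N i.
apply/eqP; apply: contraT => fi.
have := kmin `|N - i|%N; rewrite (_ : N - _ = i); last lia.
by move=> /(_ fi); lia.
Qed.

Lemma ldeg_unique f N M : has_ldeg f N -> has_ldeg f M -> N = M.
Proof.
move=> [fN fN0] [fM fM0]; case: (ltgtP N M) => // [/fN|/fM] /eqP.
  by rewrite (negbTE fM0).
by rewrite (negbTE fN0).
Qed.

(* Junk value 0 at [f = 0]. *)
Definition ldeg f : int := xget 0 [set N | has_ldeg f N].

Lemma ldegP f : f != 0 -> has_ldeg f (ldeg f).
Proof. by move=> /ldeg_exists[N fN]; exact: (xgetPex 0 (ex_intro _ N fN)). Qed.

Lemma ldeg_eq f N : has_ldeg f N -> ldeg f = N.
Proof.
move=> fN; apply: (@ldeg_unique f) => //; apply: ldegP.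
by apply: contraTneq (fN.2) => ->; rewrite lcoef0 eqxx.
Qed.

Lemma has_ldegM f g N M :
  has_ldeg f N -> has_ldeg g M -> has_ldeg (f * g) (N + M).
Proof.
move=> [fN fN0] [gM gM0]; split; first exact: conv_bound.
rewrite (_ : N + M = N + M - 0%:Z); last by rewrite subr0.
by rewrite lcoefM -/(conv f g _) convE// big_ord1 !subr0 mulf_neq0.
Qed.

Fixpoint inv_seq (f : int -> F) (N : int) k : seq F :=
  if k is k'.+1 then
    let s := inv_seq f N k' in
    rcons s (((k' == 0)%N%:R - \sum_(i < k') f (N - (k' - i)%N%:Z) * s`_i) / f N)
  else [::].

Lemma size_inv_seq f N k : size (inv_seq f N k) = k.
Proof. by elim: k => //= k IH; rewrite size_rcons IH. Qed.

Lemma nth_inv_seq f N k i :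
  (i < k)%N -> (inv_seq f N k)`_i = (inv_seq f N i.+1)`_i.
Proof.
elim: k => // k IH; rewrite ltnS leq_eqVlt => /orP[/eqP->//|ik].
by rewrite /= nth_rcons size_inv_seq ik IH.
Qed.

Lemma lmulV_ex f : f != 0 -> exists g, g * f = 1.
Proof.
move=> /ldeg_exists[N [fN fN0]].
pose u k := (inv_seq f N k.+1)`_k.
pose gf (n : int) := if n <= - N then u `|(- N - n)%R|%N else 0.
have gN : bounded_by gf (- N) by move=> n nN; rewrite /gf leNgt nN.
exists (Laurent (is_laurentP gN)); apply: lcoefP => n.
rewrite lcoefM -/(conv _ _ _) lcoef1 /=.
have [n0|n0] := ltP 0 n.
  by rewrite (conv_bound gN fN) ?gt_eqF// addNr.
have [k ->] : exists k : nat, n = (- N + N) - k%:Z by exists `|n|%N; lia.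
rewrite convE// big_ord_recr/= subnn subr0 addNr sub0r oppr_eq0.
have gu i : gf (- N - i%:Z) = u i.
  by rewrite /gf ifT; [congr u; lia|lia].
rewrite gu {1}/u /= nth_rcons size_inv_seq ltnn eqxx divfK//.
rewrite -[X in X + _ = _](_ : \sum_(i < k) f (N - (k - i)%N%:Z) * (inv_seq f N k)`_i = _).
  by rewrite addrC subrK; congr (_%:R); lia.
by apply: eq_bigr => i _; rewrite gu mulrC nth_inv_seq.
Qed.

Definition linv f : laurent := xget 0 [set g | g * f = 1].

Lemma lmulVf f : f != 0 -> linv f * f = 1.
Proof. by move=> /lmulV_ex ?; apply: (@xgetPex _ 0 [set g | g * f = 1]). Qed.

Lemma linv0 : linv 0 = 0.
Proof.
rewrite /linv; case: xgetP => // g _ /=; rewrite mulr0 => /esym/eqP.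
by rewrite oner_eq0.
Qed.

HB.instance Definition _ := GRing.ComNzRing_isField.Build laurent lmulVf linv0.

Lemma lpoly_bound (p : {poly F}) :
  bounded_by (fun n => if n is Posz k then p`_k else 0) (size p).
Proof. by move=> [k|k]// /ltW; rewrite lez_nat => kp; rewrite nth_default. Qed.

(* F[x] inside F((x^-1)). *)
Definition lpoly (p : {poly F}) : laurent := Laurent (is_laurentP (@lpoly_bound p)).

Lemma lpoly_is_zmod_morphism : zmod_morphism lpoly.
Proof. by move=> p q; apply: lcoefP => -[k|k]; rewrite lcoefB /= ?coefB ?subr0. Qed.

Lemma lpoly_is_monoid_morphism : monoid_morphism lpoly.
Proof.
split=> [|p q]; apply: lcoefP => -[k|k].
- by rewrite lcoef1 /= coef1.
- by rewrite lcoef1.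
- rewrite lcoefM; pose r := [seq i%:Z | i <- iota 0 k.+1].
  rewrite -(fsbig_widen [set` r])//; last first.
    move=> [i|i] [_] /= ir; last by rewrite mul0r.
    have {}ir : (k < i)%N.
      rewrite ltnNge; apply/negP => ik; apply: ir; apply/mapP.
      by exists i => //; rewrite mem_iota ltnS.
    by case E : (_ - _) => [j|j]; [lia|rewrite mulr0].
  rewrite -fsbig_seq; last by rewrite map_inj_uniq ?iota_uniq// => i j [].
  rewrite /r big_map -[iota 0 k.+1]/(index_iota 0 k.+1) big_mkord /= coefM.
  by apply: eq_bigr => i _ /=; rewrite subzn// -ltnS.
- rewrite lcoefM fsbig1// => -[i|i] _ /=; last by rewrite mul0r.
  by case E : (_ - _) => [j|j]; [lia|rewrite mulr0].
Qed.

HB.instance Definition _ :=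
  GRing.isZmodMorphism.Build {poly F} laurent lpoly lpoly_is_zmod_morphism.
HB.instance Definition _ :=
  GRing.isMonoidMorphism.Build {poly F} laurent lpoly lpoly_is_monoid_morphism.

Lemma has_ldeg_lpoly (p : {poly F}) :
  p != 0 -> has_ldeg (lpoly p) (size p).-1%:Z.
Proof.
move=> p0; split; last by rewrite /= -/(lead_coef p) lead_coef_eq0.
move=> [k|k]//; rewrite ltz_nat /= => pk; rewrite nth_default//.
by move: pk; rewrite -size_poly_gt0 in p0 *; lia.
Qed.

End Laurent.

(* F_q((x^-1)) as a metric space. The alias only records the type [R] of real
   numbers in which the absolute value, hence the distance, takes its values. *)
Definition Kinf (R : realType) (F : finFieldType) := laurent F.

HB.instance Definition _ (R : realType) (F : finFieldType) :=
  GRing.Field.on (Kinf R F).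
HB.instance Definition _ (R : realType) (F : finFieldType) :=
  isPointed.Build (Kinf R F) 0.

Section Kinfty.
Variables (R : realType) (F : finFieldType).
Local Notation q := (#|F|%:R : R).
Local Notation K := (Kinf R F).
Implicit Types f g h : K.

Definition Kabs f : R := if f == 0 then 0 else q ^ ldeg f.

Lemma card_gt1_R : 1 < q.
Proof. by rewrite ltr1n; exact: card_finNzRing_gt1. Qed.

Lemma card_gt0_R : 0 < q. Proof. exact: lt_trans ltr01 card_gt1_R. Qed.

Lemma Kabs0 : Kabs 0 = 0. Proof. by rewrite /Kabs eqxx. Qed.

Lemma Kabs_ldeg f (N : int) : has_ldeg f N -> Kabs f = q ^ N.
Proof.
move=> fN; rewrite /Kabs ifF ?(ldeg_eq fN)//.
by apply/eqP => f0; have := fN.2; rewrite f0 lcoef0 eqxx.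
Qed.

Lemma Kabs_ge0 f : 0 <= Kabs f.
Proof. by rewrite /Kabs; case: ifP => // _; rewrite exprz_ge0// ltW// card_gt0_R. Qed.

Lemma Kabs_eq0 f : Kabs f = 0 -> f = 0.
Proof.
rewrite /Kabs; case: eqP => // _ /eqP.
by rewrite gt_eqF// exprz_gt0// card_gt0_R.
Qed.

Lemma KabsM f g : Kabs (f * g) = Kabs f * Kabs g.
Proof.
have [->|/ldeg_exists[N fN]] := eqVneq f 0; first by rewrite mul0r Kabs0 mul0r.
have [->|/ldeg_exists[M gM]] := eqVneq g 0; first by rewrite mulr0 Kabs0 mulr0.
rewrite (Kabs_ldeg (has_ldegM fN gM)) (Kabs_ldeg fN) (Kabs_ldeg gM).
by rewrite expfzDr// gt_eqF// card_gt0_R.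
Qed.

Lemma KabsN f : Kabs (- f) = Kabs f.
Proof.
have [->|/ldeg_exists[N fN]] := eqVneq f 0; first by rewrite oppr0.
rewrite (Kabs_ldeg fN); apply: Kabs_ldeg; split.
  by move=> n Nn; rewrite lcoefN fN.1// oppr0.
by rewrite lcoefN oppr_eq0 fN.2.
Qed.

Lemma Kabs_le f (N : int) : bounded_by f N <-> Kabs f <= q ^ N.
Proof.
have [->|/ldeg_exists[M fM]] := eqVneq f 0.
  by rewrite Kabs0; split=> // _; rewrite exprz_ge0// ltW// card_gt0_R.
rewrite (Kabs_ldeg fM) ler_eXz2l ?card_gt1_R//; split=> [fN|MN n Nn].
  by rewrite leNgt; apply/negP => /fN/eqP; apply/negP/(fM.2).
by apply: fM.1; apply: le_lt_trans Nn.
Qed.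

Lemma KabsD f g : Kabs (f + g) <= Num.max (Kabs f) (Kabs g).
Proof.
wlog fg : f g / Kabs f <= Kabs g => [H|].
  have /orP[/H//|/H] := le_total (Kabs f) (Kabs g).
  by rewrite addrC maxC.
rewrite (max_r fg).
have [g0|/ldeg_exists[N gN]] := eqVneq g 0.
  have f0 : f = 0.
    by apply: Kabs_eq0; apply/eqP; rewrite eq_le Kabs_ge0 (le_trans fg)// g0 Kabs0.
  by rewrite f0 g0 addr0.
move: fg; rewrite (Kabs_ldeg gN) => /Kabs_le fN; apply/Kabs_le => n Nn.
by rewrite lcoefD fN// gN.1// addr0.
Qed.

Definition Kdist f g : R := Kabs (f - g).

Lemma Kdistxx f : Kdist f f = 0. Proof. by rewrite /Kdist subrr Kabs0. Qed.

Lemma Kdist_positivity f g : Kdist f g = 0 -> f = g.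
Proof. by move=> /Kabs_eq0/eqP; rewrite subr_eq0 => /eqP. Qed.

Lemma Kdist_sym f g : Kdist f g = Kdist g f.
Proof. by rewrite /Kdist -KabsN opprB. Qed.

Lemma Kdist_triangle g f h : Kdist f h <= Kdist f g + Kdist g h.
Proof.
rewrite /Kdist (_ : f - h = (f - g) + (g - h)); last by rewrite addrA subrK.
apply: le_trans (KabsD _ _) _.
by rewrite ge_max lerDl lerDr !Kabs_ge0.
Qed.

HB.instance Definition _ := isMetric.Build R (Kinf R F)
  Kdistxx Kdist_positivity Kdist_sym Kdist_triangle.

Lemma openKP (U : set K) : open U <->
  forall a, U a -> exists2 e, 0 < e & forall b, Kabs (a - b) < e -> U b.
Proof.
rewrite openE; split=> UP a /UP => [/nbhs_ballP[e e0 aU]|[e e0 aU]].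
  by exists e => // b ab; apply: aU; rewrite ballEmdist.
by apply/nbhs_ballP; exists e => // b; rewrite ballEmdist => /aU.
Qed.

Lemma Kabs_lpoly (p : {poly F}) :
  p != 0 -> Kabs (lpoly p : K) = q ^+ (size p).-1.
Proof. by move=> p0; rewrite (Kabs_ldeg (has_ldeg_lpoly p0)). Qed.

Definition Km : set K := [set alpha | Kabs alpha <= q^-1].

(* Haar measures of the locally compact group (K, +), as measures on the Borel
   sigma-algebra. Finiteness on compact sets follows from the normalization,
   and regularity is automatic on a locally compact separable metric space. *)
Definition is_haar
    (mu : {measure set (g_sigma_algebraType (@open K)) -> \bar R}) :=
  mu Km = 1%E /\
  forall (a : K) (A : set (g_sigma_algebraType (@open K))),
    measurable A -> mu [set (a + alpha : K) | alpha in A] = mu A.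

(* [(size b).-1] is the degree of [b], as [b != 0]. *)
Definition approx_degrees (alpha : K) (delta : R) : set nat :=
  [set d | exists a b : {poly F},
    [/\ b != 0, (size b).-1 = d & Kabs (alpha - lpoly a / lpoly b) < delta]].

(* The minimum is taken in the extended reals, where an empty set of degrees
   would give +oo; for [0 < delta] it is attained, see [deg_min_attained]. *)
Definition deg_min (alpha : K) (delta : R) : \bar R :=
  ereal_inf [set d%:R%:E | d in approx_degrees alpha delta].

Definition deg_min_at (P : {poly F}) (alpha : K) (delta : R) : \bar R :=
  ereal_inf [set deg_min (lpoly (P ^+ m) * alpha) delta | m in [set: nat]].

Lemma approx_degrees_nonempty f delta :
  0 < delta -> approx_degrees f delta !=set0.
Proof.
move=> d0; have [M fM] := laurent_bound f.
pose N := Num.bound (delta^-1).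
have qN : q ^- N.+1 < delta.
  rewrite -ltf_pV2 ?posrE ?invr_gt0 ?exprn_gt0 ?card_gt0_R// invrK.
  apply: lt_trans (archi_boundP _) _; first by rewrite invr_ge0 ltW.
  rewrite -natrX ltr_nat; apply: leq_trans (ltn_expl _ _) => //.
  exact: card_finNzRing_gt1.
pose b : {poly F} := 'X^N.
have b0 : b != 0 by rewrite monic_neq0// monicXn.
have [L fbL] := laurent_bound (f * lpoly b).
pose a := \poly_(i < `|L|.+1) (f * lpoly b : laurent F) i%:Z.
have lb0 : Kabs (lpoly b : K) != 0.
  by rewrite Kabs_lpoly// expf_neq0// gt_eqF// card_gt0_R.
exists N, a, b; split=> //; first by rewrite size_polyXn.
apply: le_lt_trans qN.
have lb0' : (lpoly b : K) != 0 by apply: contra_neq lb0 => ->; rewrite Kabs0.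
have -> : f - lpoly a / lpoly b = (f * lpoly b - lpoly a) / (lpoly b : K).
  by rewrite mulrBl mulfK.
rewrite -(ler_pM2r (_ : 0 < Kabs (lpoly b))); last by rewrite lt_def lb0 Kabs_ge0.
rewrite -KabsM divfK// Kabs_lpoly// size_polyXn /= exprS invfM mulfVK; last first.
  by rewrite expf_neq0// gt_eqF// card_gt0_R.
rewrite -exprN1; apply/Kabs_le => -[n|[|n]]// _.
rewrite lcoefB [lpoly a _]/= coef_poly ltnS; case: leqP => [|nL]; first by rewrite subrr.
by rewrite subr0 fbL//; lia.
Qed.

Lemma deg_min_attained f delta : 0 < delta ->
  exists d : nat, [/\ approx_degrees f delta d, deg_min f delta = d%:R%:E &
    forall e, approx_degrees f delta e -> (d <= e)%N].
Proof.
move=> /(approx_degrees_nonempty f)[d0 Sd0].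
have exS : exists d, `[< approx_degrees f delta d >] by exists d0; apply/asboolP.
case: (ex_minnP exS) => d /asboolP Sd dmin; exists d; split=> //; last first.
  by move=> e Se; apply: dmin; apply/asboolP.
apply/eqP; rewrite eq_le; apply/andP; split.
  by apply: ereal_inf_lbound; exists d.
apply: le_ereal_inf_tmp => _ [e Se <-]; rewrite lee_fin ler_nat.
by apply: dmin; apply/asboolP.
Qed.

End Kinfty.

(* Main.v *)
Require Import Defs.
From mathcomp Require Import all_boot all_order all_algebra.
From mathcomp Require Import all_classical all_reals all_analysis.
From mathcomp Require Import zify.

Import Order.TTheory GRing.Theory Num.Theory.
Import numFieldNormedType.Exports.
Local Open Scope classical_set_scope.
Local Open Scope ring_scope.

(** It suffices that for almost every alpha in m some P^j alpha has its
coefficients at x^-1, ..., x^-k equal to zero: then P^j alpha is within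
q^-(k+1) of a polynomial, so the denominator 1, of degree 0, will do
([deg_min_at_small_frac]).

Call this event E_j and look only at the exponents j = k n. The events E_(k n)
are independent of probability q^-k, because E_(k n) restricts k consecutive
digits of alpha in terms of the earlier ones and, as deg P >= 1, the blocks of
digits so restricted are disjoint. Independence is replaced here by a
translation argument. Let B_n ([survivors]) be the set of alpha in m that avoid
the first n of these events. Membership in B_n depends only on the coefficients
of alpha at x^-1, ..., x^-D, where D = deg P^(k n)
([invariant_below_survivors]), so B_n is invariant under translation by
c / P^(k n) for all c in m. Choosing c among the q^k elements with digits at
x^-1, ..., x^-k only, every alpha in B_n can be moved by one of these
translations into B_n and E_(k n). So q^k translates of this intersection cover
B_n, and by invariance of mu the intersection has at least the proportion q^-k
of the measure of B_n ([haar_le_small_frac]). Hence mu B_n <= (1 - q^-k)^n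
([haar_survivors]), and the set avoiding every event is null. *)

Section VanishingDigits.
Set Implicit Arguments.
Unset Strict Implicit.
Unset Printing Implicit Defensive.
Variables (R : realType) (F : finFieldType).
Local Notation K := (Kinf R F).
Local Notation q := (#|F|%:R : R).

(** * Vanishing first digits and approximation by polynomials *)

(** [Negz i] is the exponent -(i+1), so this concerns x^-1, ..., x^-k. *)
Definition small_frac (k : nat) (beta : K) : Prop :=
  forall i, (i < k)%N -> beta (Negz i) = 0.

Lemma small_frac_approx k (beta : K) : small_frac k beta ->
  exists a : {poly F}, Kabs (beta - lpoly a : K) < q ^- k.
Proof.
move=> bk; have [L bL] := laurent_bound beta.
(* The polynomial part of beta: its coefficients beyond L vanish. *)
exists (\poly_(i < `|L|.+1) beta i%:Z).
apply: (@le_lt_trans _ _ (q ^ (- k.+1%:Z))); last first.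
  by rewrite [q ^- k]exprnN ltr_eXz2l ?card_gt1_R//; lia.
apply/Kabs_le => -[n|n] kn; rewrite lcoefB /=; last first.
  by rewrite bk ?subr0//; lia.
rewrite coef_poly ltnS; case: leqP => [|nL]; first by rewrite subrr.
by rewrite subr0 bL//; lia.
Qed.

Lemma deg_min_ge0 (alpha : K) (delta : R) : (0 <= deg_min alpha delta)%E.
Proof. by apply: le_ereal_inf_tmp => _ [d _ <-]; rewrite lee_fin. Qed.

Lemma deg_min_at_small_frac k (P : {poly F}) (alpha : K) m :
  small_frac k (lpoly (P ^+ m) * alpha) -> deg_min_at P alpha (q ^- k) = 0%E.
Proof.
move=> /small_frac_approx[a ak]; apply/eqP; rewrite eq_le; apply/andP; split.
  apply: (@le_trans _ _ (deg_min (lpoly (P ^+ m) * alpha : K) (q ^- k))).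
    by apply: ereal_inf_lbound; exists m.
  apply: ereal_inf_lbound; exists 0%N => //; exists a, 1.
  by rewrite oner_neq0 size_poly1 rmorph1 divr1.
by apply: le_ereal_inf_tmp => _ [j _ <-]; exact: deg_min_ge0.
Qed.

(** * Sets that depend on finitely many digits *)

(** Membership in [B] depends only on the coefficients at exponents above [N].
Translations rather than coefficients are used because Haar measure is
invariant under the former. *)
Definition invariant_below (N : int) (B : set K) : Prop :=
  forall h alpha : K, bounded_by h N -> B alpha -> B (h + alpha).

Lemma invariant_belowW (N M : int) (B : set K) :
  M <= N -> invariant_below N B -> invariant_below M B.
Proof.
by move=> MN BN h alpha hM; apply: BN => n Nn; apply: hM; exact: le_lt_trans Nn.
Qed.

Lemma invariant_belowI N (A B : set K) : invariant_below N A ->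
  invariant_below N B -> invariant_below N (A `&` B).
Proof. by move=> AN BN h alpha hN [Aa Ba]; split; [exact: AN|exact: BN]. Qed.

Lemma invariant_belowC N (A : set K) :
  invariant_below N A -> invariant_below N (~` A).
Proof.
move=> AN h alpha hN nA Aha; apply: nA; rewrite -[alpha](addKr h).
by apply: AN => // n Nn; rewrite lcoefN hN ?oppr0.
Qed.

Lemma invariant_belowD N (A B : set K) : invariant_below N A ->
  invariant_below N B -> invariant_below N (A `\` B).
Proof.
move=> AN BN; rewrite setDE.
by apply: invariant_belowI => //; exact: invariant_belowC.
Qed.

Lemma invariant_below_Km : invariant_below (-1) (@Km R F).
Proof.
move=> h alpha h1; rewrite /Km/= -[q^-1]exprN1 => /Kabs_le a1; apply/Kabs_le.
by move=> n n1; rewrite lcoefD h1 ?a1 ?addr0.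
Qed.

Lemma lpoly_neq0 (Q : {poly F}) : Q != 0 -> (lpoly Q : K) != 0.
Proof.
move=> /has_ldeg_lpoly[_]; apply: contraNneq => Q0.
by rewrite -[lpoly Q]/(lpoly Q : K) Q0.
Qed.

Lemma bounded_by_mul_lpoly (Q : {poly F}) (h : K) (N : int) :
  Q != 0 -> bounded_by h N -> bounded_by (lpoly Q * h : K) (N + (size Q).-1%:Z).
Proof.
by move=> /has_ldeg_lpoly[QB _] hN; rewrite addrC; exact: conv_bound.
Qed.

Lemma bounded_by_div_lpoly (Q : {poly F}) (h : K) (N : int) :
  Q != 0 -> bounded_by h N -> bounded_by (h / lpoly Q : K) (N - (size Q).-1%:Z).
Proof.
move=> Q0 /(Kabs_le (R := R)) hN; apply/(Kabs_le (R := R)).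
have q0 : q != 0 by rewrite gt_eqF// card_gt0_R.
rewrite expfzDr// -exprnN ler_pdivlMr ?exprn_gt0 ?card_gt0_R//.
by rewrite -Kabs_lpoly// -KabsM divfK// lpoly_neq0.
Qed.

(** The coefficients of Q alpha at x^-1, ..., x^-k only involve those of alpha
down to x^-(k + deg Q). *)
Lemma invariant_below_small_frac k (Q : {poly F}) : Q != 0 ->
  invariant_below (- (k + size Q)%N%:Z) [set alpha | small_frac k (lpoly Q * alpha)].
Proof.
move=> Q0 h alpha hN ak i ik; have := size_poly_gt0 Q; rewrite Q0 => sQ.
by rewrite mulrDr lcoefD ak// (bounded_by_mul_lpoly Q0 hN) ?addr0//; lia.
Qed.

(** Elements bounded by [N] form a closed ball of positive radius q^N, and B is
a union of its cosets. *)
Lemma invariant_below_open N (B : set K) : invariant_below N B -> open B.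
Proof.
move=> BN; apply/openKP => a Ba; exists (q ^ N).
  by rewrite exprz_gt0// card_gt0_R.
move=> b /ltW abN; rewrite (_ : b = - (a - b) + a :> K); last first.
  by rewrite opprB subrK.
by apply: BN Ba; apply/(Kabs_le (R := R)); rewrite KabsN.
Qed.

Lemma invariant_below_measurable N (B : set K) : invariant_below N B ->
  measurable (B : set (g_sigma_algebraType (@open K))).
Proof. by move/invariant_below_open => Bo; exact: sub_sigma_algebra. Qed.

(** * Haar measure of the set avoiding vanishing digits *)

Lemma digits_bound k (c : k.-tuple F) :
  bounded_by (fun n => if n is Negz i then c`_i else 0) (-1).
Proof. by move=> [n|n] //; lia. Qed.

Definition digits k (c : k.-tuple F) : K := Laurent (is_laurentP (digits_bound c)).

Lemma small_frac_digits k (beta : K) :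
  exists c : k.-tuple F, small_frac k (beta - digits c).
Proof.
exists [tuple beta (Negz i) | i < k] => i ik; rewrite lcoefB.
have := nth_mktuple (fun j : 'I_k => beta (Negz j)) 0 (Ordinal ik).
by rewrite [digits _ _]/= => ->; rewrite subrr.
Qed.

Section Haar.
Variable mu : {measure set (g_sigma_algebraType (@open K)) -> \bar R}.
Hypothesis mu_haar : is_haar mu.

(** The fractions digits c / Q run through translations that preserve [B] and
change the first k digits of Q alpha arbitrarily. Subtracting the right one
kills these digits, so the q^k translates of the subset where they vanish cover
[B]; as only an inequality is wanted, they need not be shown disjoint. *)
Lemma haar_le_small_frac k (Q : {poly F}) (B : set K) : Q != 0 ->
  invariant_below (- (size Q)%:Z) B ->
  (mu B <= (q ^+ k)%:E *
    mu (B `&` [set alpha | small_frac k (lpoly Q * alpha : K)%R]))%E.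
Proof.
move=> Q0 BQ; set Z := [set alpha | _].
have sQ : (0 < size Q)%N by rewrite size_poly_gt0.
have BZ : invariant_below (- (k + size Q)%N%:Z) (B `&` Z).
  apply: invariant_belowI; last exact: invariant_below_small_frac.
  by apply: (invariant_belowW _ BQ); lia.
have mBZ := invariant_below_measurable BZ.
pose h (c : k.-tuple F) : K := digits c / lpoly Q.
have hQ c : bounded_by (h c) (- (size Q)%:Z).
  rewrite (_ : - _ = -1 - (size Q).-1%:Z); last by lia.
  exact/bounded_by_div_lpoly/digits_bound.
pose s := enum {:k.-tuple F}.
pose T c : set (g_sigma_algebraType (@open K)) :=
  [set (h c + alpha : K) | alpha in B `&` Z].
have TE c : T c = [set beta | (B `&` Z) (- h c + beta)].
  apply/seteqP; split=> [_ [a BZa <-]/=|b /= BZb]; first by rewrite addKr.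
  by exists (- h c + b) => //; rewrite addNKr.
have mT c : measurable (T c).
  rewrite TE; apply: (@invariant_below_measurable (- (k + size Q)%N%:Z)).
  by move=> g b gN /= BZb; rewrite addrCA; exact: BZ.
pose c0 : k.-tuple F := [tuple 0 | _ < k].
have cover : B `<=` \big[setU/set0]_(i < size s) T (nth c0 s i).
  move=> a Ba; have [c ac] := small_frac_digits k (lpoly Q * a).
  have cs : c \in s by rewrite mem_enum.
  rewrite -(bigcup_mkord _ (fun i => T (nth c0 s i))).
  exists (index c s); first by rewrite /= index_mem.
  rewrite nth_index// TE; split.
    by apply: BQ => // n Nn; rewrite lcoefN hQ ?oppr0.
  by rewrite /Z /= addrC mulrBr /h [lpoly Q * (_ / _)]mulrC divfK ?lpoly_neq0.
have mB := invariant_below_measurable BQ.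
apply: le_trans (content_subadditive mu (fun i _ => mT (nth c0 s i)) mB cover) _.
rewrite (eq_bigr (fun=> mu (B `&` Z))); last first.
  by move=> i _; exact: (mu_haar.2 (h _)).
rewrite sumr_const card_ord -cardE card_tuple.
by rewrite -natrX mule_natl.
Qed.

Variables (k : nat) (P : {poly F}).
Hypothesis P_gt1 : (1 < size P)%N.

(** Only exponents that are multiples of [k] are tested: the step from [k * m]
to [k * m.+1] raises the degree of the power of [P] by at least [k], which puts
the digits of alpha that matter in successive tests in disjoint blocks. *)
Fixpoint survivors n : set K := if n is m.+1
  then survivors m `\` [set alpha | small_frac k (lpoly (P ^+ (k * m)) * alpha)]
  else @Km R F.

Let P0 m : P ^+ m != 0.
Proof. by rewrite expf_neq0// -size_poly_gt0; apply: leq_trans P_gt1. Qed.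

Let size_P m : size (P ^+ m) = ((size P).-1 * m).+1.
Proof. by rewrite -size_exp prednK// size_poly_gt0. Qed.

(** The bound is the one required by [haar_le_small_frac] for the next test:
the earlier ones read the digits of alpha only down to x^-D, where D is the
degree of P^(k n), since deg P^(k n) >= deg P^(k (n-1)) + k. *)
Lemma invariant_below_survivors n :
  invariant_below (- (size (P ^+ (k * n)))%:Z) (survivors n).
Proof.
elim: n => [|n IHn] /=.
  by rewrite muln0 expr0 size_poly1; exact: invariant_below_Km.
have kP : (k <= (size P).-1 * k)%N by apply: leq_pmull; lia.
have sP : (size (P ^+ (k * n.+1)) = (size P).-1 * k + size (P ^+ (k * n)))%N.
  by rewrite !size_P mulnS mulnDr addnS.
apply: invariant_belowD.
  by apply: (invariant_belowW _ IHn); rewrite lerN2 lez_nat sP; lia.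
apply: (invariant_belowW _ (invariant_below_small_frac (P0 (k * n)))).
by rewrite lerN2 lez_nat sP; lia.
Qed.

(** Each test removes at least the proportion q^-k of what is left. *)
Lemma haar_survivors n : (mu (survivors n) <= ((1 - q ^- k) ^+ n)%:E)%E.
Proof.
have qk : 0 < q ^+ k by rewrite exprn_gt0// card_gt0_R.
have r0 : 0 <= 1 - q ^- k.
  by rewrite subr_ge0 invf_le1// exprn_ege1// ltW// card_gt1_R.
elim: n => [|n]; first by rewrite expr0 /= mu_haar.1.
have mS := invariant_below_measurable (@invariant_below_survivors n).
pose Z := [set alpha : K | small_frac k (lpoly (P ^+ (k * n)) * alpha)].
have mZ := invariant_below_measurable (@invariant_below_small_frac k _ (P0 (k * n))).
have DI : mu (survivors n) = (mu (survivors n.+1) + mu (survivors n `&` Z))%E.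
  exact: measureDI.
have le : (mu (survivors n) <= (q ^+ k)%:E * mu (survivors n `&` Z))%E.
  exact: haar_le_small_frac (@invariant_below_survivors n).
have : (0 <= mu (survivors n.+1))%E by exact: measure_ge0.
have : (0 <= mu (survivors n `&` Z))%E by exact: measure_ge0.
move: DI le.
case: (mu (survivors n.+1)) => [z| |]; case: (mu (survivors n `&` Z)) => [y| |] //;
  case: (mu (survivors n)) => [x| |] //.
move=> xzyE; have xzy : x = z + y := EFin_inj xzyE.
rewrite !lee_fin => xy _ _ xr; rewrite exprS.
apply: le_trans (ler_wpM2l r0 xr); rewrite mulrBl mul1r lerBrDr {2}xzy lerD2l.
by rewrite mulrC ler_pdivrMr// mulrC.
Qed.

Lemma negligible_survivors :
  mu.-negligible (\bigcap_n survivors n : set (g_sigma_algebraType (@open K))).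
Proof.
have mS n := invariant_below_measurable (@invariant_below_survivors n).
exists (\bigcap_n survivors n); split=> //; first exact: bigcapT_measurable.
set I := \bigcap_n _.
have mI : measurable (I : set (g_sigma_algebraType (@open K))).
  exact: bigcapT_measurable.
have le n : (mu I <= ((1 - q ^- k) ^+ n)%:E)%E.
  apply: le_trans (haar_survivors n).
  by apply: le_measure; rewrite ?inE//; exact: bigcap_inf.
have qk : 0 < q ^- k by rewrite invr_gt0 exprn_gt0// card_gt0_R.
have qk1 : q ^- k <= 1.
  by rewrite invf_le1 ?exprn_gt0 ?card_gt0_R// exprn_ege1// ltW// card_gt1_R.
have cv : (1 - q ^- k) ^+ n @[n --> \oo] --> 0.
  by apply: cvg_expr; rewrite ger0_norm ?subr_ge0// ltrBlDr ltrDl.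
have : (0 <= mu I)%E by exact: measure_ge0.
move: le; case: (mu I) => [x le|/(_ 0%N)|] //.
rewrite lee_fin => x0; congr EFin; apply/eqP; rewrite eq_le x0 andbT.
apply: (ler_cvg_to (cvg_cst x) cv).
by apply: nearW => n; rewrite -lee_fin; exact: le.
Qed.

End Haar.
End VanishingDigits.

Theorem theorem1p11 (R : realType) (F : finFieldType)
  (mu : {measure set (g_sigma_algebraType (@open (Kinf R F))) -> \bar R})
  (mu_haar : is_haar mu) (k : nat) (k_ge1 : (1 <= k)%N)
  (P : {poly F}) (P_irr : irreducible_poly P) :
  {ae mu, forall alpha : Kinf R F, Km alpha ->
     deg_min_at P alpha (#|F|%:R ^- k) = 0%E}.
Proof.
apply: (@negligibleS _ _ _ _ _ _ _ (negligible_survivors mu_haar k P_irr.1)).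
move=> alpha /= /not_implyP[am ndeg] n _.
elim: n => [|n IHn] //=; split=> //= /deg_min_at_small_frac.
exact: ndeg.
Qed.
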